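(* Let $a,b,\alpha\in\mathbb{R}$ and $l>0$, and let $$P(x,y)=y\{(x-a)^2+(y-b)^2-l^2\}-l\{(x-a)\sin\alpha-(y-b)\cos\alpha\}(x^2+y^2-1)\in\mathbb{R}[x,y],$$ so that $P(x,y)=0$ is the equation of the edge of the angular Voronoi diagram of the line segment $s_1$ with endpoints $(\pm1,0)$ and the line segment $s_2$ of length $2l$, midpoint $(a,b)$ and direction angle $\alpha$. Then $P$ has total degree exactly two and is factorable (i.e. is a product of two non-constant polynomials in $\mathbb{R}[x,y]$) if and only if $P$ is the product of the equations of two orthogonal lines; that is, if and only if there are real numbers $c_1,c_2,c_3,d_1,d_2,d_3$ with $(c_1,c_2)\neq(0,0)$, $(d_1,d_2)\neq(0,0)$ and $c_1d_1+c_2d_2=0$ such that $P(x,y)=(c_1y+c_2x+c_3)(d_1y+d_2x+d_3)$.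
   Context: For a line segment $s$ and a point $p$ in the plane, the visual angle $\theta_p(s)\in[0,\pi]$ is the angle formed by the two rays emanating from $p$ through the two endpoints of $s$. For a finite set of line segments $s_1,\dots,s_n$, the angular Voronoi region of $s_i$ is the set of points $p\in\mathbb{R}^2$ with $\theta_p(s_i)<\theta_p(s_j)$ for all $j\neq i$, and the edge of $s_i,s_j$ is the set of $p$ with $\theta_p(s_i)=\theta_p(s_j)<\theta_p(s_k)$ for all $k\neq i,j$. Convention: coordinates are chosen so that $s_1$ has endpoints $(1,0)$ and $(-1,0)$ (any pair of segments can be brought to this form by a similarity), and $s_2$ has length $2l$, midpoint $(a,b)$ and makes angle $\alpha$ with the $x$-axis. The ''equation of the edge'' is then $P(x,y)=0$ with $P$ as in the claim. (The angles $\alpha$ and $\alpha+\pi$ describe the same segment but give different polynomials; the claim concerns $P$ for every real $\alpha$.) *)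

(* Defs.v *)
From mathcomp Require Import all_boot all_order all_algebra.
From mathcomp Require Import reals trigo.
From mathcomp Require Import mpoly.

Set Implicit Arguments.
Unset Strict Implicit.
Unset Printing Implicit Defensive.

Import GRing.Theory.
Local Open Scope ring_scope.

Definition px (R : realType) : {mpoly R[2]} := 'X_(ord0 : 'I_2).
Definition py (R : realType) : {mpoly R[2]} := 'X_(ord_max : 'I_2).
Arguments px {R}.
Arguments py {R}.

(* Orient the segments from (1, 0) to (-1, 0) and from
   (a, b) - l (cos alpha, sin alpha) to (a, b) + l (cos alpha, sin alpha).  For
   the two vectors from (x, y) to the endpoints of each of them, the dot products
   are
     v1 = x ^ 2 + y ^ 2 - 1,   v2 = (x - a) ^ 2 + (y - b) ^ 2 - l ^ 2,
   and the cross products, last endpoint first, are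
     w1 = 2 y,   w2 = 2 l ((x - a) sin alpha - (y - b) cos alpha).
   Then edge_poly = (w1 v2 - w2 v1) / 2: its vanishing is the equality
   w1 / v1 = w2 / v2 of the tangents of the two oriented visual angles, cleared
   of denominators.  Replacing alpha by alpha + pi reverses the second segment
   and changes the polynomial. *)
Definition edge_poly (R : realType) (a b alpha l : R) : {mpoly R[2]} :=
  py * ((px - a%:MP) ^+ 2 + (py - b%:MP) ^+ 2 - (l ^+ 2)%:MP)
  - l%:MP * ((px - a%:MP) * (sin alpha)%:MP - (py - b%:MP) * (cos alpha)%:MP)
    * (px ^+ 2 + py ^+ 2 - 1).

(* [msize p] is the total degree of p plus one, and 0 for p = 0. *)
Definition has_total_degree (R : realType) (p : {mpoly R[2]}) (d : nat) : Prop :=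
  msize p = d.+1.

Definition nonconstant (R : realType) (p : {mpoly R[2]}) : Prop :=
  forall c : R, p <> c%:MP.

Definition factorable (R : realType) (p : {mpoly R[2]}) : Prop :=
  exists q r : {mpoly R[2]}, [/\ nonconstant q, nonconstant r & p = q * r].

(* Main.v *)
(** The cubic part of the edge polynomial is [(x^2 + y^2) (y - l x sin alpha +
    l y cos alpha)].  If it vanishes, then [l sin alpha = 0] and
    [l cos alpha = -1], and the coefficients of [x^2] and [y^2] become [b] and
    [- b].  Two nonconstant factors of a polynomial of degree two have degree
    one, and the sum of the coefficients of [x^2] and [y^2] in their product is
    the inner product of the normals of the two lines. *)
Require Import Defs.
From mathcomp Require Import all_boot all_order all_algebra.
From mathcomp Require Import reals trigo.
From mathcomp Require Import mpoly lra.
Import GRing.Theory.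
Local Open Scope ring_scope.

Lemma mcoeff_affine (R : realType) (c1 c2 c3 : R) (m : 'X_{1..2}) :
  (c1%:MP * py + c2%:MP * px + c3%:MP)@_m
  = c1 * (U_(ord_max)%MM == m)%:R + c2 * (U_(ord0)%MM == m)%:R
    + c3 * (m == 0%MM)%:R.
Proof. by rewrite !mcoeffD !mcoeffCM !mcoeffX mcoeffC. Qed.

(** The only monomials of degree at most one in two variables are [1], [x] and [y], so comparing
    coefficients according to [mdeg m] is enough. *)
Lemma msize2_affine (R : realType) (p : {mpoly R[2]}) :
  (msize p <= 2)%N ->
  p = (p@_U_(ord_max))%:MP * py + (p@_U_(ord0))%:MP * px + (p@_0)%:MP.
Proof.
move=> hp; apply/mpolyP => m; rewrite mcoeff_affine.
have [m0|m1|hm] := ltngtP (mdeg m) 1.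
- have /eqP -> : m == 0%MM by rewrite -mdeg_eq0 -leqn0 -ltnS.
  have U0 (i : 'I_2) : (U_(i)%MM == 0%MM) = false by rewrite -mdeg_eq0 mdeg1.
  by rewrite !U0 eqxx !mulr0 !add0r mulr1.
- have nU (i : 'I_2) : (U_(i)%MM == m) = false.
    by apply/eqP => e; move: m1; rewrite -e mdeg1.
  have n0 : (m == 0%MM) = false by rewrite -mdeg_eq0 -leqn0 leqNgt (ltnW m1).
  rewrite !nU n0 !mulr0 !addr0; apply: memN_msupp_eq0.
  exact/msize_mdeg_ge/(leq_trans hp m1).
have /mdeg1P [i /eqP ->] : mdeg m == 1%N by rewrite hm.
rewrite -mdeg_eq0 mdeg1 mulr0 addr0 !eq_mnm1.
have [->|->] : i = ord0 \/ i = ord_max.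
  by case: i => -[|[|//]] hi; [left | right]; apply: val_inj.
- by rewrite eqxx mulr0 add0r mulr1.
- by rewrite eqxx mulr0 addr0 mulr1.
Qed.

Lemma affine_nonconstant (R : realType) (c1 c2 c3 : R) :
  (c1, c2) <> (0, 0) -> nonconstant (c1%:MP * py + c2%:MP * px + c3%:MP).
Proof.
move=> hc c e; apply: hc.
have H (i : 'I_2) := congr1 (mcoeff U_(i)%MM) e.
move: (H ord0) (H ord_max).
by rewrite !mcoeff_affine !mcoeffC -!mdeg_eq0 !mdeg1 !eq_mnm1 /= !mulr0 !mulr1
  !addr0 add0r => -> ->.
Qed.

Lemma msize_affine (R : realType) (c1 c2 c3 : R) :
  (c1, c2) <> (0, 0) -> msize (c1%:MP * py + c2%:MP * px + c3%:MP) = 2.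
Proof.
move=> hc; apply/eqP; rewrite eqn_leq; apply/andP; split; last first.
  rewrite ltnNge; apply/negP => /msize1_polyC.
  exact: affine_nonconstant.
rewrite msizeE; apply/bigmax_leqP_seq => m hm _; rewrite ltnS leqNgt.
apply/negP => m1; move: hm; rewrite mcoeff_msupp mcoeff_affine.
have nU (i : 'I_2) : (U_(i)%MM == m) = false.
  by apply/eqP => e; move: m1; rewrite -e mdeg1.
have -> : (m == 0%MM) = false by rewrite -mdeg_eq0 -leqn0 leqNgt (ltnW m1).
by rewrite !nU !mulr0 !addr0 eqxx.
Qed.

Lemma nonconstant_msize_gt1 (R : realType) (p : {mpoly R[2]}) :
  nonconstant p -> (1 < msize p)%N.
Proof. by move=> hp; rewrite ltnNge; apply/negP => /msize1_polyC; exact: hp. Qed.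

Lemma affine_meval (R : realType) (v : 'I_2 -> R) (c1 c2 c3 : R) :
  (c1%:MP * py + c2%:MP * px + c3%:MP).@[v]
  = c1 * v ord_max + c2 * v ord0 + c3.
Proof. by rewrite /px /py !(mevalD, mevalM, mevalC, mevalXU). Qed.

Lemma edge_poly_meval (R : realType) (a b alpha l : R) (v : 'I_2 -> R) :
  let x := v ord0 in let y := v ord_max in
  (edge_poly a b alpha l).@[v]
  = y * ((x - a) ^+ 2 + (y - b) ^+ 2 - l ^+ 2)
    - l * ((x - a) * sin alpha - (y - b) * cos alpha) * (x ^+ 2 + y ^+ 2 - 1).
Proof.
rewrite /= /edge_poly /px /py !expr2 -mpolyC1.
by rewrite !(mevalD, mevalN, mevalM, mevalC, mevalXU).
Qed.

(** Only values on the two coordinate axes are used, which reduces the argument to linear arithmetic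
    in products of the parameters. *)
Lemma edge_poly_affine_orthogonal (R : realType)
    (a b alpha l c1 c2 c3 d1 d2 d3 : R) :
  edge_poly a b alpha l =
    (c1%:MP * py + c2%:MP * px + c3%:MP)
    * (d1%:MP * py + d2%:MP * px + d3%:MP) ->
  c1 * d1 + c2 * d2 = 0.
Proof.
move=> e.
have E x y : y * ((x - a) ^+ 2 + (y - b) ^+ 2 - l ^+ 2)
    - l * ((x - a) * sin alpha - (y - b) * cos alpha) * (x ^+ 2 + y ^+ 2 - 1)
  = (c1 * y + c2 * x + c3) * (d1 * y + d2 * x + d3).
  have := congr1 (meval (fun i : 'I_2 => if i == ord0 then x else y)) e.
  by rewrite edge_poly_meval mevalM !affine_meval.
(* On each axis, the points -1, 0, 1, 2 support a third difference and -1, 0, 1 a second one. *)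
have E00 := E 0 0; have E10 := E 1 0; have E01 := E 0 1.
have En0 := E (-1) 0; have E0n := E 0 (-1); have E20 := E 2 0; have E02 := E 0 2.
(* Third differences along the axes isolate the coefficients of x^3 and y^3. *)
have hs : l * sin alpha = 0 by lra.
have hc : l * cos alpha = -1 by lra.
(* [lra] treats nonlinear monomials as atoms, so the multiples of [hs] by [a] and of [hc] by [b] are
   supplied. *)
have hsa : l * sin alpha * a = 0 by rewrite hs mul0r.
have hcb : l * cos alpha * b = - b by rewrite hc mulN1r.
(* The discrete Laplacian at the origin gives the trace of the quadratic part. *)
lra.
Qed.

Theorem theorem4 (R : realType) (a b alpha l : R) (hl : 0 < l) :
  (has_total_degree (edge_poly a b alpha l) 2 /\
   factorable (edge_poly a b alpha l))
  <->
  (exists c1 c2 c3 d1 d2 d3 : R,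
    [/\ (c1, c2) <> (0, 0),
        (d1, d2) <> (0, 0),
        c1 * d1 + c2 * d2 = 0 &
        edge_poly a b alpha l =
          (c1%:MP * py + c2%:MP * px + c3%:MP)
          * (d1%:MP * py + d2%:MP * px + d3%:MP)]).
Proof.
split=> [[hdeg [q [r [hq hr e]]]]|[c1 [c2 [c3 [d1 [d2 [d3 [hc hd _ e]]]]]]]].
- have q1 := nonconstant_msize_gt1 _ _ hq.
  have r1 := nonconstant_msize_gt1 _ _ hr.
  have q0 : q != 0 by rewrite -msize_poly_eq0 -lt0n (ltnW q1).
  have r0 : r != 0 by rewrite -msize_poly_eq0 -lt0n (ltnW r1).
  rewrite /has_total_degree e msizeM // in hdeg.
  (* Sizes exceed degrees by one, so [msizeM] yields a predecessor. Both sizes are at least 2 and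
     their sum is 4, hence each is exactly 2. *)
  have hqr : (msize q + msize r = 4)%N.
    by rewrite -(prednK (n := msize q + msize r)%N) ?hdeg // addn_gt0 (ltnW q1).
  have q2 : (msize q <= 2)%N.
    by rewrite -(leq_add2r 2) (leq_trans _ (eq_leq hqr)) // leq_add2l.
  have r2 : (msize r <= 2)%N.
    by rewrite -(leq_add2l 2) (leq_trans _ (eq_leq hqr)) // leq_add2r.
  have eq := msize2_affine _ _ q2; have er := msize2_affine _ _ r2.
  have e' := etrans e (congr2 *%R eq er).
  exists q@_U_(ord_max), q@_U_(ord0), q@_0, r@_U_(ord_max), r@_U_(ord0), r@_0.
  split; last exact: e'.
  (* With a zero normal the factor would equal its constant term. *)
  + case=> z1 z2; apply: (hq q@_0).
    by rewrite [LHS]eq z1 z2 mpolyC0 !mul0r !add0r.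
  + case=> z1 z2; apply: (hr r@_0).
    by rewrite [LHS]er z1 z2 mpolyC0 !mul0r !add0r.
  + exact: edge_poly_affine_orthogonal e'.
(* Conversely, two factors of size 2 have a product of size 2 + 2 - 1 = 3, that is, of degree
   two. *)
have q2 := msize_affine _ _ _ c3 hc; have r2 := msize_affine _ _ _ d3 hd.
split.
  rewrite /has_total_degree e msizeM ?q2 ?r2 //.
    by rewrite -msize_poly_eq0 q2.
  by rewrite -msize_poly_eq0 r2.
by do 2!eexists; split; last exact: e; exact: affine_nonconstant.
Qed.
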